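(* Let $G$ be a finite group and let $\Bbbk$ be a (not necessarily finite) field whose multiplicative group $\Bbbk^*$ has order $|\Bbbk^*| \geq 2|G|$. Then there exists a finite-dimensional absolutely simple evolution $\Bbbk$-algebra $X$ such that, for every field extension $\mathbb{F}/\Bbbk$, the group $\operatorname{Aut}(X_{\mathbb{F}})$ of $\mathbb{F}$-algebra automorphisms of $X_{\mathbb{F}} = X\otimes_{\Bbbk}\mathbb{F}$ is isomorphic to $G$.
   Context: Algebras are not assumed associative or unital: a $\Bbbk$-algebra is a $\Bbbk$-vector space with a bilinear multiplication, and only finite-dimensional algebras are considered. An automorphism of a $\Bbbk$-algebra is a $\Bbbk$-linear isomorphism that commutes with the multiplication. An evolution $\Bbbk$-algebra is a $\Bbbk$-algebra $X$ admitting a basis $B=\{b_i : i\in\Lambda\}$ (called a natural basis) such that $b_ib_j=0$ for all $i\neq j$. An algebra $X$ is simple if $X^2\neq 0$ and $0$ is the only proper (two-sided) ideal of $X$. A $\Bbbk$-algebra $X$ is absolutely simple if for every field extension $\mathbb{F}/\Bbbk$ the $\mathbb{F}$-algebra $X_{\mathbb{F}}=X\otimes_{\Bbbk}\mathbb{F}$ is simple. If $\Bbbk$ is infinite, the condition $|\Bbbk^*|\geq 2|G|$ holds automatically. *)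

(* Defs.v *)
From HB Require Import structures.
From mathcomp Require Import all_boot all_algebra all_fingroup.
From mathcomp Require Import ring.
From mathcomp Require Import boolp classical_sets cardinality.

Set Implicit Arguments.
Unset Strict Implicit.
Unset Printing Implicit Defensive.

Import GRing.Theory.

Local Open Scope ring_scope.

(* Multiplication is not assumed associative or unital; a vectType is          *)
(* finite-dimensional.                                                        *)
Record algebra (K : fieldType) := MkAlgebra {
  carrier :> vectType K;
  amul : {bilinear carrier -> carrier -> carrier} }.

Definition is_ideal (K : fieldType) (X : algebra K) (I : {vspace X}) : Prop :=
  forall x u : X, u \in I -> amul X x u \in I /\ amul X u x \in I.

Definition simple_algebra (K : fieldType) (X : algebra K) : Prop :=
  (exists x y : X, amul X x y != 0) /\
  (forall I : {vspace X}, is_ideal I -> I != fullv -> I = 0%VS).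

Definition natural_basis (K : fieldType) (X : algebra K) (n : nat)
    (b : n.-tuple X) : Prop :=
  basis_of fullv b /\
  forall i j : 'I_n, i != j -> amul X (tnth b i) (tnth b j) = 0.

Definition evolution_algebra (K : fieldType) (X : algebra K) : Prop :=
  exists (n : nat) (b : n.-tuple X), natural_basis b.

Section Automorphisms.
Variables (K : fieldType) (X : algebra K).
Local Open Scope lfun_scope.

Definition is_automorphism : pred 'End(X) := fun f =>
  `[< bijective f /\ forall x y : X, f (amul X x y) = amul X (f x) (f y) >].

Record automorphism := Automorphism {
  aut_val :> 'End(X);
  _ : is_automorphism aut_val }.

HB.instance Definition _ := [isSub for aut_val].
HB.instance Definition _ := [Choice of automorphism by <:].

Lemma automorphismP (f : automorphism) :
  bijective f /\ forall x y : X, f (amul X x y) = amul X (f x) (f y).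
Proof. by case: f => f Pf; apply/asboolP. Qed.

Lemma aut_lker (f : automorphism) : lker f == 0%VS.
Proof. by apply/lker0P; apply: bij_inj (automorphismP f).1. Qed.

Lemma aut_one_subproof : is_automorphism \1.
Proof.
apply/asboolP; split; first by exists id => x; rewrite id_lfunE.
by move=> x y; rewrite !id_lfunE.
Qed.

Lemma aut_mul_subproof (f g : automorphism) : is_automorphism (f \o g).
Proof.
have [bf mf] := automorphismP f; have [bg mg] := automorphismP g.
apply/asboolP; split; last by move=> x y; rewrite !comp_lfunE /= mg mf.
by apply: (eq_bij (bij_comp bf bg)) => x; rewrite comp_lfunE.
Qed.

Lemma aut_inv_subproof (f : automorphism) : is_automorphism f^-1.
Proof.
have [bf mf] := automorphismP f; have kf := aut_lker f.
have fK : cancel f f^-1 by apply: lker0_lfunK.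
have Kf : cancel f^-1 f.
  by case: bf => g fg gf x; rewrite -[in LHS](gf x) fK gf.
apply/asboolP; split; first by exists f.
by move=> x y; apply: (can_inj fK); rewrite mf !Kf.
Qed.

(* The group law is composition: (f * g) x = f (g x).                         *)
Definition aut_one := Automorphism aut_one_subproof.
Definition aut_mul f g := Automorphism (aut_mul_subproof f g).
Definition aut_inv f := Automorphism (aut_inv_subproof f).

Lemma aut_mulA : associative aut_mul.
Proof. by move=> f g h; apply: val_inj; rewrite /= comp_lfunA. Qed.

Lemma aut_1mul : left_id aut_one aut_mul.
Proof. by move=> f; apply: val_inj; rewrite /= comp_lfun1l. Qed.

Lemma aut_mul1 : right_id aut_one aut_mul.
Proof. by move=> f; apply: val_inj; rewrite /= comp_lfun1r. Qed.

Lemma aut_mulV : left_inverse aut_one aut_inv aut_mul.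
Proof.
by move=> f; apply: val_inj; rewrite /= lker0_compVf ?aut_lker.
Qed.

Lemma aut_Vmul : right_inverse aut_one aut_inv aut_mul.
Proof.
move=> f; apply: val_inj; rewrite /= lker0_compfV ?aut_lker //.
Qed.

HB.instance Definition _ :=
  isGroup.Build automorphism aut_mulA aut_1mul aut_mul1 aut_mulV aut_Vmul.

End Automorphisms.

Definition group_isomorphic (G H : groupType) : Prop :=
  exists f : {multiplicative G -> H}, bijective f.

(* The algebra X_F = X (x)_K F for a field extension iota : K -> F.  Writing  *)
(* b for the K-basis [vbasis fullv] of X, the row v stands for the tensor     *)
(* \sum_i b_i (x) v_i; [scalar_extension_universal] and [tensor_mul] below    *)
(* show that this is the tensor product over K, as an algebra.                *)
Section ScalarExtension.
Variables (K : fieldType) (X : algebra K) (F : fieldType).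
Variable iota : {rmorphism K -> F}.
Local Notation n := (\dim {:X}).
Local Notation b := (vbasis {:X}).

Definition tensor (x : X) (a : F) : 'rV[F]_n :=
  \row_i (iota (coord b i x) * a).

Definition tmul (u v : 'rV[F]_n) : 'rV[F]_n :=
  \sum_(i < n) \sum_(j < n) tensor (amul X b`_i b`_j) (u 0 i * v 0 j).

Fact tmul_is_bilinear : bilinear_for
  (GRing.Scale.Law.clone _ _ *:%R _) (GRing.Scale.Law.clone _ _ *:%R _) tmul.
Proof.
split=> w a u v; rewrite /= /tmul scaler_sumr -big_split; apply: eq_bigr => i _;
  rewrite scaler_sumr -big_split; apply: eq_bigr => j _ /=;
  by apply/rowP => l; rewrite !mxE; ring.
Qed.

HB.instance Definition _ := bilinear_isBilinear.Build F _ _ _ _ _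
  tmul tmul_is_bilinear.

Definition scalar_extension : algebra F := @MkAlgebra F 'rV[F]_n tmul.

Fact tensorDl x y a : tensor (x + y) a = tensor x a + tensor y a.
Proof. by apply/rowP=> i; rewrite !mxE linearD rmorphD mulrDl. Qed.

Fact tensorDr x a c : tensor x (a + c) = tensor x a + tensor x c.
Proof. by apply/rowP=> i; rewrite !mxE mulrDr. Qed.

Fact tensor_balanced c x a : tensor (c *: x) a = tensor x (iota c * a).
Proof. by apply/rowP=> i; rewrite !mxE linearZ rmorphM /=; ring. Qed.

Fact tensor_scale x c a : tensor x (c * a) = c *: tensor x a.
Proof. by apply/rowP=> i; rewrite !mxE; ring. Qed.

Let vbasis_sum (x : X) : x = \sum_(i < n) coord b i x *: b`_i.
Proof. exact/coord_vbasis/memvf. Qed.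

Let tensor_sum (I : finType) (x : I -> X) a :
  tensor (\sum_i x i) a = \sum_i tensor (x i) a.
Proof.
apply: (big_morph (tensor^~ a)) => [x1 x2|]; first exact: tensorDl.
by apply/rowP=> i; rewrite !mxE linear0 rmorph0 mul0r.
Qed.

Let coord_b (i j : 'I_n) : coord b i b`_j = (i == j)%:R.
Proof. by rewrite coord_free ?(basis_free (vbasisP _)) // eq_sym. Qed.

Lemma tensor_mul x y a c :
  amul scalar_extension (tensor x a) (tensor y c) =
    tensor (amul X x y) (a * c).
Proof.
rewrite [in RHS](vbasis_sum x) [in RHS](vbasis_sum y) linear_sumlz tensor_sum.
apply: eq_bigr => i _; rewrite linear_sumr tensor_sum; apply: eq_bigr => j _.
rewrite linearZl_LR linearZr_LR !tensor_balanced; congr (tensor _ _).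
by rewrite !mxE; ring.
Qed.

Let row_tensor (v : 'rV[F]_n) : v = \sum_(i < n) tensor b`_i (v 0 i).
Proof.
apply/rowP=> j; rewrite summxE (bigD1 j) //= big1 => [|i ij]; rewrite !mxE coord_b.
  by rewrite eqxx rmorph1 mul1r addr0.
by rewrite eq_sym (negPf ij) rmorph0 mul0r.
Qed.

Lemma scalar_extension_universal (W : zmodType) (f : X -> F -> W) :
    (forall x y a, f (x + y) a = f x a + f y a) ->
    (forall x a c, f x (a + c) = f x a + f x c) ->
    (forall c x a, f (c *: x) a = f x (iota c * a)) ->
  exists2 g : {additive scalar_extension -> W},
    forall x a, g (tensor x a) = f x a &
    forall h : {additive scalar_extension -> W},
      (forall x a, h (tensor x a) = f x a) -> h =1 g.
Proof.
move=> fDl fDr fZ.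
pose g (v : scalar_extension) : W := \sum_(i < n) f b`_i ((v : 'rV_n) 0 i).
have f0 x : f x 0 = 0 by apply: (addrI (f x 0)); rewrite -fDr !addr0.
have f0l a : f 0 a = 0 by apply: (addrI (f 0 a)); rewrite -fDl !addr0.
have gD : nmod_morphism g.
  split=> [|u v]; first by rewrite /g big1 // => i _; rewrite mxE f0.
  by rewrite /g -big_split; apply: eq_bigr => i _; rewrite mxE fDr.
pose gA := GRing.isNmodMorphism.Build _ _ g gD.
pose G : {additive _ -> _} := HB.pack g gA.
exists G => [x a | h hE v] /=.
  rewrite [in RHS](vbasis_sum x) (big_morph (f^~ a) (fun y z => fDl y z a) (f0l a)).
  by apply: eq_bigr => i _; rewrite mxE fZ.
rewrite [v in LHS]row_tensor raddf_sum; apply: eq_bigr => i _; exact: hE.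
Qed.

End ScalarExtension.

Definition absolutely_simple (K : fieldType) (X : algebra K) : Prop :=
  forall (F : fieldType) (iota : {rmorphism K -> F}),
    simple_algebra (scalar_extension X iota).

(* Main.v *)
From HB Require Import structures.
Require Import Defs.
From mathcomp Require Import all_boot all_algebra all_fingroup.
From mathcomp Require Import boolp classical_sets cardinality.

(** Let A be a square matrix over the field, and let the algebra with basis
    b_0, ..., b_(n-1) be given by b_i b_j = 0 for i != j and
    b_i^2 = \sum_k A i k b_k.  Suppose that A is invertible, that its diagonal
    consists of ones, and that the digraph of its nonzero entries is strongly
    connected.

    Invertibility makes the squares b_i^2 a basis, so x y = 0 exactly when the
    supports of x and y are disjoint.  An automorphism therefore permutes the
    natural basis up to scalars, b_i |-> c_i b_(s i), and comparing the images
    of b_i^2 gives A i j c_j = c_i^2 A (s i) (s j).  For j = i the unit diagonal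
    turns this into c_i = c_i^2, so c_i = 1 and s is a symmetry of A
    ([automorphism_perm]); conversely every symmetry of A is an automorphism
    ([perm_automorphism]).  Strong connectedness makes the algebra simple: an
    ideal containing a nonzero vector contains some b_i^2, hence
    b_i^2 b_j = A i j b_j^2, hence all squares ([structure_matrix_simple]).
    Extending scalars only maps the entries of A along an injective field
    morphism, which preserves all these properties and the symmetries of A
    ([scalar_extension_structure_matrix], [matrix_algebra_realizes]).

    It remains to find a matrix with symmetry group G.  Take an injective
    weight w : G -> K with w 1 = 0, let W g h = w (g^-1 h), and let A be the
    block matrix

        1     W
        1   1 + W

    It is invertible whatever w is: subtracting the upper rows from the lower
    ones leaves an upper unitriangular matrix.  Left translations of G are
    symmetries.  Row sums in the lower half exceed those in the upper half by
    1, so a symmetry preserves the two halves; the lower left identity block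
    forces it to act in the same way on both; and injectivity of w makes
    g^-1 h an invariant, so that it is a left translation
    ([cayley_mx_perm]).  The digraph is strongly connected as soon as G has two
    elements; the trivial group is realized by the one-dimensional algebra
    with b^2 = b. *)

Set Implicit Arguments.
Unset Strict Implicit.
Unset Printing Implicit Defensive.

Import GRing.Theory.

(** * Algebras given by a structure matrix *)

Section StructureMatrix.
Local Open Scope ring_scope.
Variable F : fieldType.

Definition has_structure_matrix (Y : algebra F) n (b : n.-tuple Y)
    (A : 'M[F]_n) : Prop :=
  basis_of fullv b /\
  forall i j : 'I_n,
    amul Y b`_i b`_j = if i == j then \sum_k A i k *: b`_k else 0.

Definition strongly_connected n (A : 'M[F]_n) : Prop :=
  forall i j, connect (fun k l => A k l != 0) i j.

Definition evolution_mul n (A : 'M[F]_n) (u v : 'rV[F]_n) : 'rV[F]_n :=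
  (\row_i (u 0 i * v 0 i)) *m A.

Lemma evolution_mul_is_bilinear n (A : 'M[F]_n) : bilinear_for
  (GRing.Scale.Law.clone _ _ *:%R _) (GRing.Scale.Law.clone _ _ *:%R _)
  (evolution_mul A).
Proof.
split=> w a u v; rewrite /evolution_mul /= scalemxAl -mulmxDl; congr (_ *m _);
  apply/rowP => i; rewrite !mxE.
  by rewrite mulrDl mulrA.
by rewrite mulrDr mulrCA.
Qed.

HB.instance Definition _ n (A : 'M[F]_n) := bilinear_isBilinear.Build F _ _ _ _ _
  (evolution_mul A) (evolution_mul_is_bilinear A).

Definition matrix_algebra n (A : 'M[F]_n) : algebra F :=
  @MkAlgebra F 'rV[F]_n (evolution_mul A).

Lemma basis_of_generating (Y : vectType F) n (b : n.-tuple Y) :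
    \dim {:Y} = n ->
    (forall y : Y, exists c : 'I_n -> F, y = \sum_i c i *: b`_i) ->
  basis_of fullv b.
Proof.
move=> dimY gen; rewrite basisEdim size_tuple dimY leqnn andbT.
apply/subvP=> y _; have [c ->] := gen y.
by apply: memv_suml => i _; apply/memvZ/memv_span/mem_nth; rewrite size_tuple.
Qed.

Lemma matrix_algebraP n (A : 'M[F]_n) :
  exists b : n.-tuple (matrix_algebra A), has_structure_matrix b A.
Proof.
pose b : n.-tuple (matrix_algebra A) := [tuple delta_mx 0 i : 'rV_n | i < n].
have bE (i : 'I_n) : b`_i = delta_mx 0 i by rewrite -tnth_nth tnth_mktuple.
exists b; split=> [|i j].
  apply: basis_of_generating => [|y]; first by rewrite dimvf; exact: mul1n.
  exists ((y : 'rV_n) 0); rewrite [LHS](row_sum_delta y).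
  by apply: eq_bigr => i _; rewrite bE.
rewrite !bE /= /evolution_mul.
pose d i' : 'rV[F]_n := delta_mx 0 i'.
have -> : \row_k (d i 0 k * d j 0 k) = (i == j)%:R *: d i.
  apply/rowP=> k; rewrite !mxE /=.
  by have [-> | _] := eqVneq k i; rewrite ?eqxx ?(mul1r, mulr1, mul0r, mulr0).
rewrite -scalemxAl -rowE.
case: eqP => _; last by rewrite scale0r.
rewrite scale1r (row_sum_delta (row i A)).
by apply: eq_bigr => k _; rewrite bE mxE.
Qed.

Section Regular.
Variables (Y : algebra F) (n : nat) (b : n.-tuple Y) (A : 'M[F]_n).
Hypothesis bA : has_structure_matrix b A.

Let sq i := \sum_k A i k *: b`_k.

Lemma structure_matrix_natural : natural_basis b.
Proof.
split=> [|i j /negPf neq_ij]; first exact: bA.1.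
by rewrite !(tnth_nth 0) bA.2 neq_ij.
Qed.

Lemma sum_coord y : y = \sum_i coord b i y *: b`_i.
Proof. exact: coord_basis bA.1 (memvf y). Qed.

Lemma coord_sum (c : 'I_n -> F) i : coord b i (\sum_k c k *: b`_k) = c i.
Proof. exact/coord_sum_free/basis_free/bA.1. Qed.

Lemma coord_natural (i j : 'I_n) : coord b i b`_j = (j == i)%:R.
Proof. exact/coord_free/basis_free/bA.1. Qed.

Lemma structure_matrix_mul x y :
  amul Y x y = \sum_i (coord b i x * coord b i y) *: sq i.
Proof.
rewrite {1}(sum_coord x) {1}(sum_coord y) linear_sumlz.
apply: eq_bigr => i _; rewrite linear_sumr (bigD1 i) //= big1 ?addr0.
  by rewrite linearZl_LR linearZr_LR /= bA.2 eqxx scalerA.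
move=> j /negPf; rewrite eq_sym linearZl_LR linearZr_LR /= bA.2 => ->.
by rewrite !scaler0.
Qed.

Lemma eq_lfun_basis (f g : 'End(Y)) :
  (forall i : 'I_n, f b`_i = g b`_i) -> f = g.
Proof.
move=> fg; apply/lfunP=> y; rewrite (sum_coord y) !linear_sum.
by apply: eq_bigr => i _; rewrite !linearZ /= fg.
Qed.

Lemma lfun_of_basis (t : 'I_n -> Y) :
  exists f : 'End(Y), forall i : 'I_n, f b`_i = t i.
Proof.
have [f fE] := linear_of_free b [tuple t i | i < n].
exists (linfun f) => i; rewrite lfunE /=.
have := fE (basis_free bA.1); rewrite !size_tuple => /(_ erefl) mapE.
by rewrite -(nth_map 0 0) ?size_tuple // mapE -tnth_nth tnth_mktuple.
Qed.

Hypothesis unitA : A \in unitmx.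

(** The coordinates of the combination form the row vector c A, and A is
    invertible. *)
Lemma square_comb_inj (c : 'I_n -> F) :
  \sum_i c i *: sq i = 0 -> forall i, c i = 0.
Proof.
move=> c0; have: (\row_i c i) *m A = 0.
  apply/rowP=> k; rewrite !mxE.
  have := congr1 (coord b k) c0; rewrite linear0 linear_sum => ck0.
  rewrite -[RHS]ck0.
  by apply: eq_bigr => i _; rewrite linearZ /= coord_sum mxE.
move/(congr1 (mulmx^~ (invmx A))); rewrite mulmxK // mul0mx => /rowP c0' i.
by have := c0' i; rewrite !mxE.
Qed.

Lemma basis_square_comb (k : 'I_n) : b`_k = \sum_i invmx A k i *: sq i.
Proof.
under eq_bigr => i _ do rewrite /sq scaler_sumr.
rewrite exchange_big /=.
transitivity (\sum_j (k == j)%:R *: b`_j).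
  rewrite (bigD1 k) //= eqxx scale1r big1 ?addr0 // => j.
  by rewrite eq_sym => /negPf->; rewrite scale0r.
apply: eq_bigr => j _; have /matrixP/(_ k j) := mulVmx unitA.
rewrite !mxE => <-; rewrite scaler_suml.
by apply: eq_bigr => i _; rewrite scalerA.
Qed.

Lemma square_neq0 i : sq i != 0.
Proof.
apply/eqP=> sq0.
have: \sum_j (j == i)%:R *: sq j = 0.
  by apply: big1 => j _; case: eqP => [->|_]; rewrite ?sq0 ?scaler0 ?scale0r.
by move/square_comb_inj/(_ i)/eqP; rewrite eqxx oner_eq0.
Qed.

(** The vertex [i0] only excludes dimension 0, where the product vanishes. *)
Lemma structure_matrix_simple (i0 : 'I_n) :
  strongly_connected A -> simple_algebra Y.
Proof.
move=> connA; split.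
  by exists b`_i0, b`_i0; rewrite bA.2 eqxx; exact: square_neq0.
move=> I idealI properI; apply/eqP/negPn/negP => nzI; case/eqP: properI.
have [i sq_i] : exists i, sq i \in I.
  have : vpick I != 0 by rewrite vpick0.
  rewrite [X in X != 0](sum_coord (vpick I)) => nz_v.
  have [i nz_i | z] := pickP (fun i => coord b i (vpick I) != 0); last first.
    case/eqP: nz_v; apply: big1 => i _; move: (z i) => /negbFE/eqP->.
    by rewrite scale0r.
  (* Multiplying by b_i isolates the i-th coordinate: b_i v = v_i b_i^2. *)
  exists i; have [+ _] := idealI b`_i _ (memv_pick I).
  rewrite structure_matrix_mul (bigD1 i) //= big1 => [|j /negPf ji].
    rewrite addr0 coord_natural eqxx mul1r.
    by rewrite rpredZeq (negPf nz_i).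
  by rewrite coord_natural eq_sym ji mul0r scale0r.
(* Membership propagates along the edges because b_k^2 b_l = A k l b_l^2. *)
have sqI j : sq j \in I.
  have /connectP[p + ->] := connA i j; elim: p (i) sq_i => //= l p IHp k sq_k.
  case/andP=> nz_kl; apply: IHp; have [_] := idealI b`_l _ sq_k.
  rewrite structure_matrix_mul (bigD1 l) //= big1 => [|m /negPf ml].
    rewrite addr0 coord_natural eqxx mulr1 coord_sum.
    by rewrite rpredZeq (negPf nz_kl).
  by rewrite coord_natural eq_sym ml mulr0 scale0r.
apply/eqP; rewrite eqEsubv subvf /=; apply/subvP=> y _; rewrite (sum_coord y).
apply: memv_suml => k _; rewrite basis_square_comb; apply: memvZ.
by apply: memv_suml => j _; apply: memvZ.
Qed.

Hypothesis diagA : forall i, A i i = 1.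

(** The rows of the matrix P of f have pairwise disjoint supports, because the
    images of distinct basis vectors multiply to 0 and the squares are
    independent.  There are as many rows as columns, so each support is a single
    column; the unit diagonal then forces the remaining scalar to be 1. *)
Lemma automorphism_perm (f : automorphism Y) :
  exists2 s : 'S_n, forall i : 'I_n, f b`_i = b`_(s i) &
    forall i j, A (s i) (s j) = A i j.
Proof.
have [bij_f mulf] := automorphismP f.
pose P (i k : 'I_n) := coord b k (f b`_i).
have fb (i : 'I_n) : f b`_i = \sum_k P i k *: b`_k by apply: sum_coord.
have fb_mul (i j : 'I_n) :
    amul Y (f b`_i) (f b`_j) = \sum_k (P i k * P j k) *: sq k.
  exact: structure_matrix_mul.
have P_disj i j k : i != j -> P i k * P j k = 0.
  move=> /negPf neq_ij; move: k; apply: square_comb_inj.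
  by rewrite -fb_mul -mulf bA.2 neq_ij linear0.
have ex_s i : exists k, P i k != 0.
  have [k nz | z] := pickP (fun k => P i k != 0); first by exists k.
  have : f b`_i = f 0.
    rewrite linear0 fb big1 // => k _.
    by move: (z k) => /negbFE/eqP->; rewrite scale0r.
  move/(bij_inj bij_f) => b0; have := coord_natural i i.
  by rewrite b0 linear0 eqxx => /esym/eqP; rewrite oner_eq0.
pose s i := xchoose (ex_s i).
have nz_s i : P i (s i) != 0 by apply: xchooseP (ex_s i).
have s_inj : injective s.
  move=> i j eq_s; apply/eqP/negPn/negP=> ne_ij.
  have /eqP := P_disj i j (s i) ne_ij.
  by rewrite mulf_eq0 (negPf (nz_s i)) eq_s (negPf (nz_s j)).
have P_s i k : s i != k -> P i k = 0.
  have [s' _ s'K] := injF_bij s_inj; rewrite -(s'K k) => ne_ik.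
  have ne_i : i != s' k by apply: contra ne_ik => /eqP->.
  have /eqP := P_disj i (s' k) (s (s' k)) ne_i.
  by rewrite mulf_eq0 (negPf (nz_s _)) orbF => /eqP.
pose c i := P i (s i).
have fbE (i : 'I_n) : f b`_i = c i *: b`_(s i).
  rewrite fb (bigD1 (s i)) //= big1 ?addr0 // => k.
  by rewrite eq_sym => /P_s->; rewrite scale0r.
(* Both sides are the coordinate on b_(s j) of the image of b_i^2. *)
have Ac i j : A i j * c j = c i ^+ 2 * A (s i) (s j).
  have : f (sq i) = (c i ^+ 2) *: sq (s i).
    have := mulf b`_i b`_i; rewrite bA.2 eqxx => ->.
    by rewrite fbE linearZl_LR linearZr_LR /= bA.2 eqxx scalerA expr2.
  move/(congr1 (coord b (s j))); rewrite linearZ /= coord_sum => <-.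
  rewrite /sq !linear_sum (bigD1 j) //= big1 => [|k ne_kj].
    by rewrite addr0 !linearZ /= fbE linearZ /= coord_natural eqxx mulr1.
  rewrite !linearZ /= fbE linearZ /= coord_natural.
  by rewrite (inj_eq s_inj) (negPf ne_kj) !mulr0.
have c1 i : c i = 1.
  have := Ac i i; rewrite !diagA mul1r mulr1 expr2 => /esym.
  by rewrite -[RHS]mulr1 => /(mulfI (nz_s i)).
exists (perm s_inj) => [i | i j]; rewrite !permE.
  by rewrite fbE c1 scale1r.
by have := Ac i j; rewrite !c1 expr1n mulr1 mul1r.
Qed.

Lemma perm_automorphism (s : 'S_n) :
    (forall i j, A (s i) (s j) = A i j) ->
  exists f : automorphism Y, forall i : 'I_n, f b`_i = b`_(s i).
Proof.
move=> sA; have [u uE] := lfun_of_basis (fun i => b`_(s i)).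
have [v vE] := lfun_of_basis (fun i => b`_(s^-1%g i)).
have bij_u : bijective u.
  exists v => y; rewrite -comp_lfunE -[RHS]id_lfunE; congr (fun_of_lfun _ y);
    apply: eq_lfun_basis => i; rewrite comp_lfunE id_lfunE.
    by rewrite uE vE permK.
  by rewrite vE uE permKV.
have coord_u y i : coord b (s i) (u y) = coord b i y.
  rewrite {1}(sum_coord y) linear_sum (reindex_inj (@perm_inj _ s^-1%g)) /=.
  under eq_bigr => k _ do rewrite linearZ /= uE permKV.
  by rewrite coord_sum permK.
have u_sq i : u (sq i) = sq (s i).
  rewrite /sq linear_sum [RHS](reindex_inj (@perm_inj _ s)) /=.
  by apply: eq_bigr => k _; rewrite linearZ /= uE sA.
have aut_u : is_automorphism u.
  apply/asboolP; split=> // x y; rewrite !structure_matrix_mul linear_sum.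
  rewrite [RHS](reindex_inj (@perm_inj _ s)) /=.
  by apply: eq_bigr => i _; rewrite !coord_u linearZ /= u_sq.
by exists (Automorphism aut_u).
Qed.

(** The action is composed like automorphisms, (g h) x = g (h x), whereas the
    product of ['S_n] composes in the opposite order; this is why G acts through
    bare functions. *)
Lemma automorphism_group_perm (G : finGroupType) (act : G -> 'I_n -> 'I_n) :
    (forall i, act 1%g i = i) ->
    (forall g h i, act (g * h)%g i = act g (act h i)) ->
    (forall g h, act g =1 act h -> g = h) ->
    (forall g i j, A (act g i) (act g j) = A i j) ->
    (forall s : 'S_n, (forall i j, A (s i) (s j) = A i j) ->
       exists g, s =1 act g) ->
  group_isomorphic (automorphism Y) G.
Proof.
move=> act1 actM act_faithful actA act_all.
have act_inj g : injective (act g).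
  by apply: (can_inj (g := act g^-1%g)) => i; rewrite -actM mulVg act1.
have b_inj (i j : 'I_n) : b`_i = b`_j -> i = j.
  move/(congr1 (coord b j)); rewrite !coord_natural eqxx.
  by case: eqP => // _ /esym/eqP; rewrite oner_eq0.
have ex_phi (f : automorphism Y) :
    exists g, forall i : 'I_n, f b`_i = b`_(act g i).
  have [s fE /act_all[g sE]] := automorphism_perm f.
  by exists g => i; rewrite fE sE.
have [phi phiE] := choice ex_phi.
have phi_uniq (f : automorphism Y) g :
    (forall i : 'I_n, f b`_i = b`_(act g i)) -> phi f = g.
  by move=> fE; apply: act_faithful => i; apply: b_inj; rewrite -phiE fE.
have phiM : {morph phi : f g / (f * g)%g}.
  by move=> f g; apply: phi_uniq => i; rewrite actM comp_lfunE !phiE.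
have phi_surj g : exists f, phi f = g.
  have [|f fE] := @perm_automorphism (perm (act_inj g)).
    by move=> i j; rewrite !permE.
  by exists f; apply: phi_uniq => i; rewrite fE permE.
have phi_inj : injective phi.
  move=> f g eq_fg; apply: val_inj; apply: eq_lfun_basis => i.
  by rewrite [LHS]phiE [RHS]phiE eq_fg.
pose Phi : {multiplicative automorphism Y -> G} :=
  HB.pack phi (isMultiplicative.Build _ _ phi phiM).
exists Phi; have [psi psiK] := choice phi_surj.
by exists psi => // f; apply: phi_inj; rewrite psiK.
Qed.

End Regular.

End StructureMatrix.

(** * Structure matrices and extension of scalars *)

Section ScalarExtension.
Local Open Scope ring_scope.
Variables (K : fieldType) (X : algebra K) (F : fieldType).
Variable iota : {rmorphism K -> F}.

Lemma tensor_lincomb n (b : n.-tuple X) (c : 'I_n -> K) a :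
  tensor iota (\sum_i c i *: b`_i) a =
    \sum_i (a * iota (c i)) *: tensor iota b`_i 1.
Proof.
have tensor0 : tensor iota (0 : X) a = 0.
  by apply/rowP=> i; rewrite !mxE linear0 rmorph0 mul0r.
rewrite (big_morph (tensor iota ^~ a) (fun x y => tensorDl iota x y a) tensor0).
apply: eq_bigr => i _.
by rewrite tensor_balanced mulrC -[X in tensor _ _ X]mulr1 tensor_scale.
Qed.

Lemma tensor_vbasis_sum (v : scalar_extension X iota) :
  v = \sum_(j < \dim {:X}) tensor iota (vbasis {:X})`_j ((v : 'rV_ _) 0 j).
Proof.
apply/rowP=> k; rewrite summxE (bigD1 k) //= big1 => [|j /negPf jk];
  rewrite !mxE coord_free ?(basis_free (vbasisP _)) //.
  by rewrite eqxx rmorph1 mul1r addr0.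
by rewrite jk rmorph0 mul0r.
Qed.

(** The tensors b_i (x) 1 span, since each vector of the reference basis of X
    is a combination of the b_i, and there are as many of them as the dimension
    of the extension. *)
Lemma scalar_extension_structure_matrix n (b : n.-tuple X) (A : 'M[K]_n) :
    has_structure_matrix b A ->
  exists b' : n.-tuple (scalar_extension X iota),
    has_structure_matrix b' (map_mx iota A).
Proof.
move=> bA.
pose b' : n.-tuple (scalar_extension X iota) :=
  [tuple tensor iota b`_i 1 | i < n].
have bE (i : 'I_n) : b'`_i = tensor iota b`_i 1.
  by rewrite -tnth_nth tnth_mktuple.
exists b'; split=> [|i j].
  apply: basis_of_generating => [|y].
    by rewrite dimvf -(size_basis bA.1); exact: mul1n.
  pose d i (j : 'I_(\dim {:X})) := coord b i (vbasis {:X})`_j.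
  exists (fun i => \sum_j (y : 'rV_ _) 0 j * iota (d i j)).
  rewrite [LHS]tensor_vbasis_sum.
  under [RHS]eq_bigr => i _ do rewrite scaler_suml.
  rewrite exchange_big; apply: eq_bigr => j _.
  rewrite {1}(sum_coord bA (vbasis {:X})`_j) tensor_lincomb.
  by apply: eq_bigr => i _; rewrite bE.
rewrite !bE tensor_mul bA.2 mulr1; case: eqP => _.
  by rewrite tensor_lincomb; apply: eq_bigr => k _; rewrite mxE bE mul1r.
by apply/rowP=> k; rewrite !mxE linear0 rmorph0 mul0r.
Qed.

End ScalarExtension.

(** * A matrix whose symmetries are the left translations of a group *)

Section CayleyMatrix.
Local Open Scope ring_scope.
Variables (G : finGroupType) (F : fieldType).
Local Notation n := #|G|.

Definition translation_mx (w : G -> F) : 'M[F]_n :=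
  \matrix_(i, j) w ((enum_val i)^-1 * enum_val j)%g.

(** The vertices form two copies of G, the [lshift] and the [rshift] half. *)
Definition cayley_mx (w : G -> F) : 'M[F]_(n + n) :=
  let W := translation_mx w in block_mx 1%:M W 1%:M (1%:M + W).

Definition left_translation (g : G) (i : 'I_n) : 'I_n :=
  enum_rank (g * enum_val i)%g.

Definition cayley_act (g : G) (x : 'I_(n + n)) : 'I_(n + n) :=
  match split x with
  | inl i => lshift n (left_translation g i)
  | inr i => rshift n (left_translation g i)
  end.

Variant side_spec : 'I_(n + n) -> Prop :=
  | LeftSide i : side_spec (lshift n i)
  | RightSide i : side_spec (rshift n i).

Lemma sideP x : side_spec x.
Proof. by rewrite -(splitK x); case: (split x) => i; constructor. Qed.

Lemma cayley_act_lshift g i :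
  cayley_act g (lshift n i) = lshift n (left_translation g i).
Proof. by rewrite /cayley_act (unsplitK (inl i)). Qed.

Lemma cayley_act_rshift g i :
  cayley_act g (rshift n i) = rshift n (left_translation g i).
Proof. by rewrite /cayley_act (unsplitK (inr i)). Qed.

Let cayley_actE := (cayley_act_lshift, cayley_act_rshift).

Lemma left_translation1 i : left_translation 1%g i = i.
Proof. by rewrite /left_translation mul1g enum_valK. Qed.

Lemma left_translationM g h i :
  left_translation (g * h)%g i = left_translation g (left_translation h i).
Proof. by rewrite /left_translation enum_rankK mulgA. Qed.

Lemma left_translation_inj g : injective (left_translation g).
Proof. by move=> i j /enum_rank_inj/mulgI/enum_val_inj. Qed.

Lemma cayley_act1 x : cayley_act 1%g x = x.
Proof. by case: (sideP x) => i; rewrite cayley_actE left_translation1. Qed.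

Lemma cayley_actM g h x :
  cayley_act (g * h)%g x = cayley_act g (cayley_act h x).
Proof. by case: (sideP x) => i; rewrite !cayley_actE left_translationM. Qed.

Lemma cayley_act_faithful g h : cayley_act g =1 cayley_act h -> g = h.
Proof.
move=> /(_ (lshift n (enum_rank 1%g))); rewrite !cayley_actE.
by move/lshift_inj/enum_rank_inj; rewrite enum_rankK; apply: mulIg.
Qed.

Section Weight.
Variable w : G -> F.

(** The inverse below is the product of the two block eliminations that reduce
    the matrix to the identity: lower rows minus upper rows, then upper rows
    minus W times lower rows. *)
Lemma cayley_mx_unit : cayley_mx w \in unitmx.
Proof.
set W := translation_mx w.
have : block_mx (1%:M + W) (- W) (- 1%:M) 1%:M *m cayley_mx w = 1%:M.
  rewrite /cayley_mx mulmx_block !mulmx1 !mul1mx mulNmx mulmxDl mulmxDr mulNmx.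
  rewrite !mul1mx !mulmx1 scalar_mx_block; congr block_mx.
  - by rewrite addrK.
  - by rewrite subrr.
  - by rewrite addNr.
  - by rewrite addrCA addNr addr0.
by case/mulmx1_unit.
Qed.

Let weight (i j : 'I_n) := w ((enum_val i)^-1 * enum_val j)%g.

Lemma cayley_mxE i j :
  [/\ cayley_mx w (lshift n i) (lshift n j) = (i == j)%:R,
      cayley_mx w (lshift n i) (rshift n j) = weight i j,
      cayley_mx w (rshift n i) (lshift n j) = (i == j)%:R &
      cayley_mx w (rshift n i) (rshift n j) = (i == j)%:R + weight i j].
Proof.
by rewrite /cayley_mx block_mxEul block_mxEur block_mxEdl block_mxEdr !mxE.
Qed.

Lemma cayley_mx_act g x y :
  cayley_mx w (cayley_act g x) (cayley_act g y) = cayley_mx w x y.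
Proof.
have weightE i j :
    weight (left_translation g i) (left_translation g j) = weight i j.
  by rewrite /weight !enum_rankK invMg -mulgA mulKg.
case: (sideP x) => i; case: (sideP y) => j; rewrite !cayley_actE;
  have [ul ur dl dr] := cayley_mxE i j;
  have [ul' ur' dl' dr'] :=
    cayley_mxE (left_translation g i) (left_translation g j).
- by rewrite ul ul' (inj_eq (@left_translation_inj g)).
- by rewrite ur ur' weightE.
- by rewrite dl dl' (inj_eq (@left_translation_inj g)).
- by rewrite dr dr' (inj_eq (@left_translation_inj g)) weightE.
Qed.

Hypothesis w1 : w 1%g = 0.

Let weight_diag i : weight i i = 0.
Proof. by rewrite /weight mulVg. Qed.

Lemma cayley_mx_diag x : cayley_mx w x x = 1.
Proof.
case: (sideP x) => i; have [ul ur dl dr] := cayley_mxE i i.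
  by rewrite ul eqxx.
by rewrite dr weight_diag eqxx addr0.
Qed.

(** A symmetry preserves row sums, so in any characteristic this keeps it from
    exchanging the two halves. *)
Lemma cayley_mx_row_sum i :
  \sum_y cayley_mx w (rshift n i) y = 1 + \sum_y cayley_mx w (lshift n i) y.
Proof.
have sum1 : \sum_(j < n) (i == j)%:R = 1 :> F.
  by rewrite (bigD1 i) //= eqxx big1 ?addr0 // => j; rewrite eq_sym => /negPf->.
rewrite -sum1 !big_split_ord /= addrCA; congr (_ + _).
  by apply: eq_bigr => j _; have [-> _ -> _] := cayley_mxE i j.
rewrite -big_split /=; apply: eq_bigr => j _.
by have [_ -> _ ->] := cayley_mxE i j.
Qed.

Hypothesis w_inj : injective w.

Lemma weight_neq0 i j : i != j -> weight i j != 0.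
Proof.
apply: contra => /eqP; rewrite -w1 => /w_inj/(congr1 (mulg (enum_val i))).
by rewrite mulKVg mulg1 => /enum_val_inj->.
Qed.

(** Distinct vertices of the right half are joined by an edge, each of them has
    an edge to its copy in the left half, and each left vertex has an edge to
    some right vertex as soon as there is another group element. *)
Lemma cayley_mx_strongly_connected :
  (1 < #|G|)%N -> strongly_connected (cayley_mx w).
Proof.
move=> Gnt; pose e x y := cayley_mx w x y != 0.
have RL i : connect e (rshift n i) (lshift n i).
  apply: connect1; have [_ _ dl _] := cayley_mxE i i.
  by rewrite /e dl eqxx oner_eq0.
have RR i j : connect e (rshift n i) (rshift n j).
  have [-> | ij] := eqVneq i j; first exact: connect0.
  apply: connect1; have [_ _ _ dr] := cayley_mxE i j.
  by rewrite /e dr (negPf ij) add0r weight_neq0.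
have LR i j : connect e (lshift n i) (rshift n j).
  have [k ik] : exists k, i != k.
    have /card_gt0P[k] : (0 < #|predC1 i|)%N.
      by rewrite cardC1 card_ord -ltnS prednK // ltnW.
    by rewrite inE eq_sym; exists k.
  apply: connect_trans (RR k j); apply: connect1.
  by have [_ ur _ _] := cayley_mxE i k; rewrite /e ur weight_neq0.
move=> x y; case: (sideP x) => i; case: (sideP y) => j //.
- exact: connect_trans (LR i j) (RL j).
- exact: connect_trans (RR i j) (RL j).
Qed.

(** Row sums show that s preserves both halves, acting as t and r; the lower
    left block, an identity matrix, gives r = t; and the upper right block with
    injective w gives (t i)^-1 (t j) = i^-1 j, so that t is the left translation
    by the image of 1. *)
Lemma cayley_mx_perm (s : 'S_(n + n)) :
    (forall x y, cayley_mx w (s x) (s y) = cayley_mx w x y) ->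
  exists g, s =1 cayley_act g.
Proof.
move=> sA; pose rs x := \sum_y cayley_mx w x y.
have rs_s x : rs (s x) = rs x.
  by rewrite /rs (reindex_inj (@perm_inj _ s)); apply: eq_bigr => y _.
(* The map j |-> i^-1 j permutes G, so this sum does not depend on i. *)
have row_weight i : rs (lshift n i) = 1 + \sum_g w g.
  rewrite /rs big_split_ord /=; congr (_ + _).
    rewrite (bigD1 i) //= big1 ?addr0.
      by have [-> _ _ _] := cayley_mxE i i; rewrite eqxx.
    by move=> j; have [-> _ _ _] := cayley_mxE i j; rewrite eq_sym => /negPf->.
  rewrite [RHS](reindex (fun j : 'I_n => (enum_val i)^-1 * enum_val j)%g) /=.
    by apply: eq_bigr => j _; have [] := cayley_mxE i j.
  exists (fun g => enum_rank (enum_val i * g)%g) => j _.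
    by rewrite mulKVg enum_valK.
  by rewrite enum_rankK mulKg.
have sL i : exists j, s (lshift n i) = lshift n j.
  have := rs_s (lshift n i); case: (sideP (s _)) => j; first by exists j.
  rewrite {1}/rs cayley_mx_row_sum -/(rs _) !row_weight -[RHS]add0r.
  move/addIr/eqP.
  by rewrite oner_eq0.
have sR i : exists j, s (rshift n i) = rshift n j.
  have := rs_s (rshift n i); case: (sideP (s _)) => j; last by exists j.
  rewrite {2}/rs cayley_mx_row_sum -/(rs _) !row_weight -[LHS]add0r.
  move/addIr/esym/eqP.
  by rewrite oner_eq0.
have [t tE] := choice sL; have [r rE] := choice sR.
have rt i : r i = t i.
  have := sA (rshift n i) (lshift n i); rewrite tE rE.
  have [_ _ -> _] := cayley_mxE i i; have [_ _ -> _] := cayley_mxE (r i) (t i).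
  by rewrite eqxx; case: eqP => // _ /esym/eqP; rewrite oner_eq0.
have t_weight i j :
    ((enum_val (t i))^-1 * enum_val (t j) = (enum_val i)^-1 * enum_val j)%g.
  apply: w_inj; have := sA (lshift n i) (rshift n j); rewrite tE rE rt.
  have [_ -> _ _] := cayley_mxE i j.
  by have [_ -> _ _] := cayley_mxE (t i) (t j).
pose i1 := enum_rank 1%g : 'I_n.
exists (enum_val (t i1)) => x.
have tr j : t j = left_translation (enum_val (t i1)) j.
  apply: enum_val_inj; rewrite enum_rankK.
  apply: (mulgI (enum_val (t i1))^-1%g).
  by rewrite t_weight enum_rankK invg1 mul1g mulKg.
by case: (sideP x) => j; rewrite cayley_actE ?tE ?rE ?rt tr.
Qed.

End Weight.

End CayleyMatrix.

(** * Realizing the group *)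

Section Realization.
Local Open Scope ring_scope.
Variables (G : finGroupType) (K : fieldType).

(** All conditions are on A alone: being unit, having ones on the diagonal, the
    zero pattern and equalities between entries are unchanged along a field
    morphism. *)
Lemma matrix_algebra_realizes n (A : 'M[K]_n) (act : G -> 'I_n -> 'I_n) :
    'I_n -> A \in unitmx -> (forall i, A i i = 1) -> strongly_connected A ->
    (forall i, act 1%g i = i) ->
    (forall g h i, act (g * h)%g i = act g (act h i)) ->
    (forall g h, act g =1 act h -> g = h) ->
    (forall g i j, A (act g i) (act g j) = A i j) ->
    (forall s : 'S_n, (forall i j, A (s i) (s j) = A i j) ->
       exists g, s =1 act g) ->
  exists X : algebra K,
    evolution_algebra X /\ absolutely_simple X /\
    forall (F : fieldType) (iota : {rmorphism K -> F}),
      group_isomorphic (automorphism (scalar_extension X iota)) G.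
Proof.
move=> i0 unitA diagA connA act1 actM act_faithful actA act_all.
have [b bA] := matrix_algebraP A.
have unitA' (F : fieldType) (iota : {rmorphism K -> F}) :
    map_mx iota A \in unitmx.
  by rewrite map_unitmx.
exists (matrix_algebra A); split; last split.
- by exists n, b; apply: structure_matrix_natural bA.
- move=> F iota.
  have [b' b'A] := scalar_extension_structure_matrix iota bA.
  apply: (structure_matrix_simple b'A (unitA' F iota) i0) => i j.
  rewrite (eq_connect (e' := fun k l => A k l != 0)) // => k l.
  by rewrite mxE fmorph_eq0.
- move=> F iota; have [b' b'A] := scalar_extension_structure_matrix iota bA.
  apply: (automorphism_group_perm b'A (unitA' F iota) _ act1 actM act_faithful).
  + by move=> i; rewrite mxE diagA rmorph1.
  + by move=> g i j; rewrite !mxE actA.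
  + move=> s sA; apply: act_all => i j.
    by have := sA i j; rewrite !mxE => /fmorph_inj.
Qed.

(** Translating an injection of G into the units by its value at 1 makes it
    vanish there. *)
Lemma injective_weight :
    ([set: 'I_(2 * #|G|)] #<= [set a : K | a \is a GRing.unit])%classic%card ->
  exists2 w : G -> K, injective w & w 1%g = 0.
Proof.
move=> /card_leP/injfunPex[f _ f_inj].
have le2 : (#|G| <= 2 * #|G|)%N by rewrite leq_pmull.
pose u (g : G) : K := val (f (SigSub (mem_setT (widen_ord le2 (enum_rank g))))).
have u_inj : injective u.
  move=> g h /val_inj/f_inj; rewrite !inE => /(_ I I)/(congr1 val) /= eq_gh.
  by apply: enum_rank_inj; apply: val_inj; have := congr1 val eq_gh.
exists (fun g => u g - u 1%g); last exact: subrr.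
by move=> g h /addIr/u_inj.
Qed.

End Realization.

Theorem theorem1 (G : finGroupType) (K : fieldType)
  (cardK : ([set: 'I_(2 * #|G|)] #<= [set a : K | a \is a GRing.unit])%classic%card) :
  exists X : algebra K,
    evolution_algebra X /\
    absolutely_simple X /\
    forall (F : fieldType) (iota : {rmorphism K -> F}),
      group_isomorphic (automorphism (scalar_extension X iota)) G.
Proof.
have [w w_inj w1] := injective_weight cardK.
have [Gtriv | Gnt] := leqP #|G| 1.
  apply: (@matrix_algebra_realizes G K 1 1%:M%R (fun _ i => i) ord0) => //.
  - exact: unitmx1.
  - by move=> i; rewrite mxE eqxx.
  - by move=> i j; rewrite !ord1.
  - by move=> g h _; apply: (card_le1_eqP Gtriv).
  - by exists 1%g => i; rewrite [LHS]ord1 [RHS]ord1.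
exact: (matrix_algebra_realizes (lshift _ (enum_rank 1%g)) (cayley_mx_unit w)
  (cayley_mx_diag w1) (cayley_mx_strongly_connected w1 w_inj Gnt)
  (@cayley_act1 G) (@cayley_actM G) (@cayley_act_faithful G)
  (cayley_mx_act w) (cayley_mx_perm w_inj)).
Qed.
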